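(* Let $d\ge2$, $0<a<b<\infty$, and let $\mathbb P^u$, $u\in(a,b)$, be a family of probability measures on $(\Omega,\mathcal F)$, where $\Omega=\{0,1\}^{\mathbb Z^d}$. Let $\beta,\gamma,\zeta>0$ be the exponents for which condition D(a) (in part (a) below), respectively D(b) (in part (b) below), is assumed. Let $\theta>1$ be such that $(\theta+1)\zeta>1$ and consider the scales given by integers $$l_0,r_0,L_0\geq 1,\quad l_k = l_0\, 4^{\lfloor k^\theta\rfloor},\quad r_k = r_0\, 2^{\lfloor k^\theta\rfloor},\quad L_k = l_{k-1}L_{k-1},\quad k\geq 1.$$ Let $\overline G$ be a family of seed events such that for some $u'\in(a,b)$, $$\liminf_{L_0\to\infty}\ \sup_{x\in \mathbb G_0} \mathbb P^{u'}\left[\overline G_x\right] = 0. \qquad ( * )$$ (a) If all $\overline G_x$ are increasing and the family $\mathbb P^u$ satisfies D(a), then for any $u\in(a,u')$ there exists $C=C(u,u')$ such that for all $l_0\geq 1$, all $r_0\geq C(1+\log l_0)^{\frac{2}{\gamma}}$ and some $L_0\geq 1$, $$\sup_{x\in\mathbb G_k} \mathbb P^u\left[\overline G_{x,k}\right] \leq 2^{-2^k} ,\qquad k\geq 0. \qquad ( ** )$$ (b) If all $\overline G_x$ are decreasing and the family $\mathbb P^u$ satisfies D(b), then for any $u\in(u',b)$ there exists $C=C(u,u')$ such that for all $l_0\geq 1$, all $r_0\geq C(1+\log l_0)^{\frac{2}{\gamma}}$ and some $L_0\geq 1$, $( ** )$ holds. Furthermore, if the limit (as $L_0\to\infty$)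 in $( * )$ exists (and equals $0$), then there exists $C'=C'(u,u',l_0,\overline G)$ such that statements (a) and (b) hold for all $L_0\geq C'$.
   Context: $\mathcal F$ is the $\sigma$-algebra on $\Omega=\{0,1\}^{\mathbb Z^d}$ generated by the coordinate maps $\Psi_x$, $x\in\mathbb Z^d$. $\|\cdot\|$ is the $\ell_\infty$-norm and $\mathrm B(x,r)=\{y\in\mathbb Z^d:\|y-x\|\le r\}$. An event is increasing if its indicator is non-decreasing in each coordinate of $\omega$, and decreasing if its complement is increasing. Condition D(a): there exist constants $C<\infty$, $c>0$ and $\beta,\gamma,\zeta>0$ such that for all $L,s\ge1$, $x_1,x_2\in\mathbb R^d$ with $\|x_1-x_2\|=sL$ and $a<u<u'<b$, if $A_i\in\sigma(\Psi_y:y\in\mathrm B(x_i,L))$, $i=1,2$, are increasing events, then $$\mathbb P^u[A_1\cap A_2]\le\mathbb P^{u'}[A_1]\,\mathbb P^{u'}[A_2]+C\exp\left(-c\min\left\{(u'-u)^\beta s^\gamma,\ e^{(\log L)^\zeta}\right\}\right).$$ Condition D(b): there exist constants $C<\infty$, $c>0$ and $\beta,\gamma,\zeta>0$ such that for the same range of $L,s,x_1,x_2,u,u'$, if $B_i\in\sigma(\Psi_y:y\in\mathrm B(x_i,L))$, $i=1,2$, are decreasing events, then $$\mathbb P^{u'}[B_1\cap B_2]\le\mathbb P^{u}[B_1]\,\mathbb P^{u}[B_2]+C\exp\left(-c\min\left\{(u'-u)^\beta s^\gamma,\ e^{(\log L)^\zeta}\right\}\right).$$ ($L,s$ are real numbers.)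 Cascading events: given the scales, let $\mathbb G_k=L_k\mathbb Z^d$ for $k\ge0$, and $\Lambda_{x,k}=\mathbb G_{k-1}\cap(x+[0,L_k)^d)$ for $k\ge1$, $x\in\mathbb G_k$. A family of seed events $\overline G=(\overline G_x: L_0\ge1,\ x\in\mathbb G_0)$ consists, for each $L_0\ge1$ and $x\in\mathbb G_0=L_0\mathbb Z^d$, of an event $\overline G_x=\overline G_{x,0}\in\sigma(\Psi_y,\ y\in x+[-L_0,3L_0)^d)$ (the dependence on $L_0$ is omitted from the notation). For $k\ge1$ and $x\in\mathbb G_k$, define recursively $$\overline G_{x,k}=\bigcup_{\substack{x_1,x_2\in\Lambda_{x,k}\\ \|x_1-x_2\|>r_{k-1}L_{k-1}}}\overline G_{x_1,k-1}\cap\overline G_{x_2,k-1}.$$ Constants $C(u,u')$ and $C'(u,u',l_0,\overline G)$ may in addition depend on $d,a,b,\theta$ and the constants in condition D, but on none of the other quantities.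
   Formalization: The constant C' is allowed to depend also on the family P^u (not only on u, u', l_0, the seed events, d, a, b, θ and the constants in D), since the speed of convergence in ( * ) depends on it; the constant C remains uniform in P^u. *)

(* Defs.v *)
From HB Require Import structures.
From mathcomp Require Export all_boot all_order all_algebra.
From mathcomp Require Export all_classical all_reals all_analysis.
Export Order.TTheory GRing.Theory Num.Theory.
Export numFieldNormedType.Exports.

Set Implicit Arguments.
Unset Strict Implicit.
Unset Printing Implicit Defensive.

Local Open Scope classical_set_scope.
Local Open Scope ring_scope.

(** The library norm on ['rV[int]_d] and ['rV[R]_d] is the sup norm. *)

Section Configurations.
Variable d : nat.

Definition coord (x : 'rV[int]_d) : ('rV[int]_d -> bool) -> bool :=
  fun w => w x.

Definition coord_gen (S : set 'rV[int]_d) : set (set ('rV[int]_d -> bool)) :=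
  \bigcup_(x in S) preimage_set_system setT (coord x) measurable.

(** {0,1}^(Z^d) with the product sigma-algebra. *)
Definition config : Type := g_sigma_algebraType (coord_gen setT).

HB.instance Definition _ := Measurable.on config.

Definition sigma_coord (S : set 'rV[int]_d) : set (set config) :=
  <<s coord_gen S >>.

(** Monotonicity of the indicator of [A] in each coordinate separately. *)
Definition increasing_event (A : set config) : Prop :=
  forall (x : 'rV[int]_d) (w w' : config),
    (forall y, y != x -> w y = w' y) -> (w x ==> w' x) -> A w -> A w'.

Definition decreasing_event (A : set config) : Prop := increasing_event (~` A).

(** The lattice n Z^d. *)
Definition lattice (n : nat) : set 'rV[int]_d := range (fun z => n%:Z *: z).

(** The discrete box (x + [p, q)^d) in Z^d. *)
Definition cube (x : 'rV[int]_d) (p q : int) : set 'rV[int]_d :=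
  [set y | forall i, x 0 i + p <= y 0 i < x 0 i + q].

Definition lball (R : realType) (x : 'rV[R]_d) (r : R) : set 'rV[int]_d :=
  [set y | `|map_mx intr y - x| <= r].

End Configurations.

Section ConditionD.
Variables (R : realType) (d : nat).

Definition decoupling_error (C c beta gamma zeta h s L : R) : R :=
  C * expR (- c * Order.min (h `^ beta * s `^ gamma) (expR (ln L `^ zeta))).

(** Conditions D(a) and D(b) with their constants made explicit. Only the
    measures [P u] with [a < u < b] matter. *)
Definition cond_Da (a b : R) (P : R -> probability (config d) R)
    (C c beta gamma zeta : R) : Prop :=
  forall (L s : R) (x1 x2 : 'rV[R]_d) (u u' : R) (A1 A2 : set (config d)),
    1 <= L -> 1 <= s -> `|x1 - x2| = s * L ->
    a < u -> u < u' -> u' < b ->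
    sigma_coord (lball x1 L) A1 -> sigma_coord (lball x2 L) A2 ->
    increasing_event A1 -> increasing_event A2 ->
    (P u (A1 `&` A2) <= P u' A1 * P u' A2 +
       (decoupling_error C c beta gamma zeta (u' - u) s L)%:E)%E.

Definition cond_Db (a b : R) (P : R -> probability (config d) R)
    (C c beta gamma zeta : R) : Prop :=
  forall (L s : R) (x1 x2 : 'rV[R]_d) (u u' : R) (B1 B2 : set (config d)),
    1 <= L -> 1 <= s -> `|x1 - x2| = s * L ->
    a < u -> u < u' -> u' < b ->
    sigma_coord (lball x1 L) B1 -> sigma_coord (lball x2 L) B2 ->
    decreasing_event B1 -> decreasing_event B2 ->
    (P u' (B1 `&` B2) <= P u B1 * P u B2 +
       (decoupling_error C c beta gamma zeta (u' - u) s L)%:E)%E.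

End ConditionD.

Section Cascade.
Variables (R : realType) (d : nat).

(** [truncn] is the floor on nonnegative reals. *)
Definition scale_l (theta : R) (l0 k : nat) : nat :=
  (l0 * 4 ^ Num.truncn (k%:R `^ theta))%N.

Definition scale_r (theta : R) (r0 k : nat) : nat :=
  (r0 * 2 ^ Num.truncn (k%:R `^ theta))%N.

Fixpoint scale_L (theta : R) (l0 L0 k : nat) : nat :=
  if k is j.+1 then (scale_l theta l0 j * scale_L theta l0 L0 j)%N else L0.

(** [G L0 x] is the seed event at [x] for the base scale [L0]; it is only
    meaningful for [1 <= L0] and [x] in [lattice L0]. *)
Definition seed_family (G : nat -> 'rV[int]_d -> set (config d)) : Prop :=
  forall L0 x, (1 <= L0)%N -> lattice L0 x ->
    sigma_coord (cube x (- L0%:Z) (3 * L0%:Z)) (G L0 x).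

Definition seed_increasing (G : nat -> 'rV[int]_d -> set (config d)) : Prop :=
  forall L0 x, (1 <= L0)%N -> lattice L0 x -> increasing_event (G L0 x).

Definition seed_decreasing (G : nat -> 'rV[int]_d -> set (config d)) : Prop :=
  forall L0 x, (1 <= L0)%N -> lattice L0 x -> decreasing_event (G L0 x).

Fixpoint cascade (theta : R) (l0 r0 L0 : nat)
    (G : nat -> 'rV[int]_d -> set (config d))
    (k : nat) (x : 'rV[int]_d) : set (config d) :=
  if k is j.+1 then
    let Lambda := lattice (scale_L theta l0 L0 j) `&`
                  cube x 0 (scale_L theta l0 L0 j.+1)%:Z in
    \bigcup_(p in [set p : 'rV[int]_d * 'rV[int]_d |
                   [/\ Lambda p.1, Lambda p.2 &
                    (scale_r theta r0 j * scale_L theta l0 L0 j)%N%:Z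
                      < `|p.1 - p.2|]])
      (cascade theta l0 r0 L0 G j p.1 `&` cascade theta l0 r0 L0 G j p.2)
  else G L0 x.

Definition seed_sup (P : probability (config d) R)
    (G : nat -> 'rV[int]_d -> set (config d)) (L0 : nat) : \bar R :=
  ereal_sup [set P (G L0 x) | x in lattice L0].

Definition cascade_bound (theta : R) (l0 r0 L0 : nat)
    (P : probability (config d) R)
    (G : nat -> 'rV[int]_d -> set (config d)) : Prop :=
  forall k : nat,
    (ereal_sup [set P (cascade theta l0 r0 L0 G k x)
               | x in lattice (scale_L theta l0 L0 k)]
     <= (2 ^- (2 ^ k)%N : R)%:E)%E.

(** [P] is the law at [u] and [P'] the law at [u'], for which the seed
    assumption is made. The threshold [C'] is chosen before [r0], and it may
    depend on [P'] because the speed of the seed convergence does. *)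
Definition cascade_conclusion (theta gamma C : R)
    (P P' : probability (config d) R)
    (G : nat -> 'rV[int]_d -> set (config d)) : Prop :=
  (forall l0 r0 : nat, (1 <= l0)%N -> (1 <= r0)%N ->
     C * (1 + ln l0%:R) `^ (2 / gamma) <= r0%:R ->
     exists2 L0 : nat, (1 <= L0)%N & cascade_bound theta l0 r0 L0 P G)
  /\
  (seed_sup P' G @ \oo --> 0%E ->
   forall l0 : nat, (1 <= l0)%N ->
   exists C' : R, forall r0 L0 : nat, (1 <= r0)%N -> (1 <= L0)%N ->
     C * (1 + ln l0%:R) `^ (2 / gamma) <= r0%:R ->
     C' <= L0%:R ->
     cascade_bound theta l0 r0 L0 P G).

End Cascade.

(* Main.v *)
(** The argument is an induction over scales with sprinkling: at scale [k] the
    parameter is [2^-k] of the way from [u] to [u'], and the claim is that the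
    scale-[k] events have probability at most [exp (- w_k)] with
    [w_k = ln 2 * 2^k + 2 b (1 + ln l0) (3/2)^k]. A union bound over at most
    [l_k^(2d)] pairs of separated boxes and decoupling give
    [p_(k+1) <= l_k^(2d) (p_k^2 + error)]. The correction [(3/2)^k] is chosen so
    that [2 w_k - w_(k+1) = b (1 + ln l0) (3/2)^k] absorbs
    [ln (2 l_k^(2d))], which grows only like [ln l0 + k^theta]. The error is at
    most [exp (- 2 w_k)]: its first exponent is large because [r_k] grows like
    [2^(k^theta)] with [theta > 1], its second because [ln L_k] is at least of
    order [k^(theta + 1)] with [(theta + 1) zeta > 1], small [k] being handled
    by a large [L_0]. Finally, decoupling from the sure event placed far away
    shows that local events of the relevant kind have monotone probability,
    so the bound at [2^-k] passes to [u]. *)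
Require Import Defs.
From mathcomp Require Import ring lra zify.

Set Implicit Arguments.
Unset Strict Implicit.
Unset Printing Implicit Defensive.

Local Open Scope classical_set_scope.
Local Open Scope ring_scope.

(** * Growth of the scales *)

Section Growth.
Variable R : realType.
Implicit Types (theta p A K : R) (k m : nat).

Lemma ge_powRV (x y p : R) : 0 < p -> 0 <= x -> x `^ p^-1 <= y -> x <= y `^ p.
Proof.
move=> p0 x0 xy; have y0 : 0 <= y by apply: le_trans xy; exact: powR_ge0.
rewrite -[leLHS](powRr1 x0) -(mulVf (lt0r_neq0 p0)) powRrM.
by apply: ge0_ler_powR; rewrite ?nnegrE ?powR_ge0 // ltW.
Qed.

(** Since m^p = m^(p-1) * m, it suffices that m exceed |A|^(1/(p-1)). *)
Lemma natr_powR_superlinear p A : 1 < p ->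
  exists m0, forall m, (m0 <= m)%N -> A * m%:R <= m%:R `^ p.
Proof.
move=> p1; have p10 : 0 < p - 1 by rewrite subr_gt0.
exists (Num.truncn (`|A| `^ (p - 1)^-1)).+1 => m hm.
have hA : A <= m%:R `^ (p - 1).
  apply: le_trans (ler_norm A) _; apply: ge_powRV => //.
  apply: le_trans (ltW (truncnS_gt _)) _.
  by rewrite ler_nat.
rewrite -(mulr_powRB1 (ler0n R m)); last by lra.
by rewrite mulrC ler_wpM2l.
Qed.

(** The constant loss [M] covers the finitely many k below the threshold of the superlinear
    bound. *)
Lemma natr_powR_superaffine p A : 1 < p -> 0 <= A ->
  exists2 M, 0 <= M & forall k, A * k%:R - M <= k%:R `^ p.
Proof.
move=> p1 A0; have [m0 hm0] := natr_powR_superlinear A p1.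
exists (A * m0%:R) => [|k]; first by rewrite mulr_ge0.
have [km|mk] := leqP m0 k.
  by apply: le_trans (hm0 _ km); rewrite gerBl mulr_ge0.
apply: le_trans (powR_ge0 _ _).
by rewrite subr_le0 ler_wpM2l // ler_nat ltnW.
Qed.

(** Writing q^k = exp (k ln q), the term of degree floor p + 1 of the exponential series already
    dominates. The case k = 0 is separate because k^p <= k^(floor p + 1) uses k >= 1. *)
Lemma natr_powR_le_exp p q : 0 < p -> 1 < q ->
  exists2 M : R, 0 <= M & forall k, k%:R `^ p <= M * q ^+ k.
Proof.
move=> p0 q1; set n := Num.truncn p.
have lq : 0 < ln q by rewrite ln_gt0.
have lqn : 0 < ln q ^+ n.+1 by rewrite exprn_gt0.
exists ((n.+1)`!%:R / ln q ^+ n.+1) => [|k]; first by rewrite divr_ge0 // ltW.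
have q0 : 0 < q by lra.
have hq : q ^+ k = expR (k%:R * ln q).
  by rewrite expRM_natl ?lnK ?posrE.
case: k hq => [|k] hq.
  by rewrite powR0 ?lt0r_neq0 // expr0 mulr1 divr_ge0 // ltW.
have h1 : k.+1%:R `^ p <= (k.+1%:R : R) ^+ n.+1.
  rewrite -powR_mulrn //; apply: ler_powR; first by rewrite ler1n.
  exact: ltW (truncnS_gt _).
apply: le_trans h1 _.
have := @expR_ge1Dxn R (k.+1%:R * ln q) n _.
rewrite -hq => /(_ _)/wrap[]; first by rewrite mulr_ge0 // ltW.
rewrite exprMn => h.
rewrite mulrAC ler_pdivlMr // mulrC -ler_pdivrMl ?ltr0n ?fact_gt0 //.
by rewrite mulrC [_ ^+ _ * _]mulrC; lra.
Qed.

Definition floor_powR theta k := Num.truncn (k%:R `^ theta : R).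

Lemma floor_powR_mono theta j k : 0 <= theta -> (j <= k)%N ->
  (floor_powR theta j <= floor_powR theta k)%N.
Proof.
move=> th0 jk; apply: le_truncn.
by apply: ge0_ler_powR; rewrite ?nnegrE ?ler_nat.
Qed.

(** Only the upper half of the indices is kept: there are at least [k./2] of them, each contributing
    at least the value at [k./2]. This gives ln L_k its order k^(theta + 1). *)
Lemma sum_floor_powR_ge theta k : 0 <= theta ->
  (k./2 * floor_powR theta k./2 <= \sum_(j < k) floor_powR theta j)%N.
Proof.
move=> th0; rewrite -(big_mkord xpredT).
rewrite (@big_cat_nat _ _ _ k./2) //=; last by rewrite -divn2 leq_div.
apply: leq_trans (leq_addl _ _).
apply: (@leq_trans (\sum_(k./2 <= i < k) floor_powR theta k./2)).
  rewrite sum_nat_const_nat leq_mul2r; apply/orP; right.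
  by lia.
rewrite big_nat_cond [leqRHS]big_nat_cond; apply: leq_sum => i.
move=> /andP[/andP[hi _] _].
exact: floor_powR_mono.
Qed.

(** A real x >= 1 is less than floor x + 1 <= 2 floor x; at m = 0 both sides vanish. *)
Lemma powR_le_floor_double theta m : 0 < theta ->
  m%:R `^ theta <= 2 * (floor_powR theta m)%:R.
Proof.
move=> th0; case: m => [|m]; first by rewrite powR0 ?lt0r_neq0 ?mulr_ge0.
have h1 : 1 <= m.+1%:R `^ theta.
  rewrite -[leLHS](powRr0 m.+1%:R); apply: ler_powR; last exact: ltW.
  by rewrite ler1n.
have := truncnS_gt (m.+1%:R `^ theta : R).
have : (1 <= floor_powR theta m.+1)%N by rewrite truncn_gt0.
rewrite -(ler_nat R) /floor_powR -natr1; lra.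
Qed.

Lemma scale_l_gt0 theta l0 k : (0 < l0)%N -> (0 < scale_l theta l0 k)%N.
Proof. by move=> h; rewrite muln_gt0 h expn_gt0. Qed.

Lemma scale_L_gt0 theta l0 L0 k : (0 < l0)%N -> (0 < L0)%N ->
  (0 < scale_L theta l0 L0 k)%N.
Proof.
by move=> hl hL; elim: k => //= k IH; rewrite muln_gt0 IH scale_l_gt0.
Qed.

Lemma scale_L_ge theta l0 L0 k : (0 < l0)%N ->
  (L0 * 4 ^ (\sum_(j < k) floor_powR theta j) <= scale_L theta l0 L0 k)%N.
Proof.
move=> hl; elim: k => [|k IH]; first by rewrite big_ord0 muln1.
rewrite big_ord_recr /= expnD mulnA mulnC leq_mul //.
by rewrite /scale_l leq_pmull.
Qed.

(** The factor 3 anticipates decoupling on balls of radius 3 L_k. *)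
Lemma ln_scale_L_ge theta l0 L0 k : 0 < theta -> (0 < l0)%N -> (0 < L0)%N ->
  ln 4 / 2 * (k./2)%:R `^ (theta + 1)
  <= ln (3 * (scale_L theta l0 L0 k)%:R : R).
Proof.
move=> th0 hl hL; set m := k./2; set S := (\sum_(j < k) floor_powR theta j)%N.
have h1 : (4 : R) ^+ S <= 3 * (scale_L theta l0 L0 k)%:R.
  rewrite -natrX -natrM ler_nat.
  apply: leq_trans (leq_trans (leq_pmull _ hL) (scale_L_ge theta L0 k hl)) _.
  by rewrite leq_pmull.
have h2 : (m * floor_powR theta m <= S)%N.
  by apply: sum_floor_powR_ge; exact: ltW.
have ln4 : 0 < ln (4 : R) by rewrite ln_gt0 // ltr1n.
have : ln ((4 : R) ^+ S) <= ln (3 * (scale_L theta l0 L0 k)%:R : R).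
  by rewrite ler_ln ?posrE ?exprn_gt0 // mulr_gt0 // ltr0n scale_L_gt0.
apply: le_trans; rewrite lnXn // -[leRHS]mulr_natr -mulrA ler_wpM2l //;
  first exact: ltW.
have := powR_le_floor_double m th0; set f := floor_powR theta m in h2 *.
have -> : m%:R `^ (theta + 1) = m%:R * m%:R `^ theta :> R.
  have h := mulr_powRB1 (ler0n R m) (addr_gt0 th0 ltr01).
  by rewrite -h addrK.
move=> h3; apply: (@le_trans _ _ ((m * f)%:R : R)); last by rewrite ler_nat.
by rewrite mulrC ler_pdivrMr // natrM -mulrA ler_wpM2l // mulrC.
Qed.

(** Controls the second exponent of the decoupling error: (ln L_k)^zeta is superlinear in k for
    large k, and a large [L0] settles the remaining k. One [N] serves all [l0] and [k]. *)
Lemma scale_L_threshold theta zeta K : 0 < theta -> 0 < zeta ->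
  1 < (theta + 1) * zeta ->
  exists N : nat, forall l0 L0 k, (0 < l0)%N -> (0 < L0)%N -> (N <= L0)%N ->
    K * 2 ^+ k <= expR (ln (3 * (scale_L theta l0 L0 k)%:R) `^ zeta).
Proof.
move=> th0 z0 thz; wlog K1 : K / 1 <= K.
  move=> /(_ (Num.max K 1))[|N hN]; first by rewrite le_max lexx orbT.
  exists N => l0 L0 k hl hL hN0; apply: le_trans (hN _ _ k hl hL hN0).
  by rewrite ler_wpM2r ?exprn_ge0 // le_max lexx.
have ln2 : 0 < ln (2 : R) by rewrite ln_gt0 // ltr1n.
have ln4 : 0 < ln (4 : R) by rewrite ln_gt0 // ltr1n.
have lK : 0 <= ln K by exact: ln_ge0.
set c1 : R := (ln 4 / 2) `^ zeta.
have c10 : 0 < c1 by rewrite powR_gt0 // divr_gt0.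
(* With m = [k./2], ln K + k ln 2 <= a + b m because k <= 2 m + 1; for m >= 1 this is at most (a +
   b) m, whence the slope below. *)
set a := ln K + ln 2; set b := 2 * ln 2 : R.
have [m0 hm0] := natr_powR_superlinear ((a + b) / c1) thz.
have a0 : 0 < a by rewrite /a; lra.
have b0 : 0 < b by rewrite /b; lra.
set T := a + b * m0%:R.
have T0 : 0 <= T by rewrite addr_ge0 ?mulr_ge0 // ltW.
exists (Num.truncn (expR (T `^ zeta^-1))).+1 => l0 L0 k hl hL hN.
have L3 : (1 : R) <= 3 * (scale_L theta l0 L0 k)%:R.
  by rewrite -natrM ler1n muln_gt0 /= scale_L_gt0.
have -> : K * 2 ^+ k = expR (ln K + k%:R * ln 2).
  by rewrite expRD expRM_natl !lnK ?posrE //; lra.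
rewrite ler_expR; set m := k./2.
have hk : ln K + k%:R * ln 2 <= a + b * m%:R.
  rewrite /a /b -addrA lerD2l.
  have : (k <= 2 * m + 1)%N by rewrite /m; lia.
  rewrite -(ler_nat R) natrD natrM => ?; nra.
(* If m <= m0, the target is at most [T] and [L0] alone suffices. Splitting at [m0.+1] ensures m >=
   1 in the other case. *)
apply: (le_trans hk); have [mm|mm] := leqP m0.+1 m; last first.
  apply: (@le_trans _ _ T); first by rewrite lerD2l ler_pM2l // ler_nat.
  apply: ge_powRV => //.
  rewrite -[leLHS]expRK ler_ln ?posrE ?expR_gt0 //; last by lra.
    apply: le_trans (ltW (truncnS_gt _)) _; rewrite -natrM ler_nat.
    apply: (leq_trans hN); apply: leq_trans (leq_pmull _ (isT : 0 < 3)%N).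
    apply: leq_trans (scale_L_ge theta L0 k hl).
    by rewrite leq_pmulr // expn_gt0.
have m1 : (1 : R) <= m%:R by rewrite ler1n; apply: leq_ltn_trans mm.
apply: (@le_trans _ _ (c1 * m%:R `^ ((theta + 1) * zeta))).
  rewrite -ler_pdivrMl //; apply: le_trans (hm0 _ (ltnW mm)).
  by rewrite [leRHS]mulrAC [leLHS]mulrC ler_pM2r ?invr_gt0 //
    mulrDl lerD2r ler_peMr // ltW.
rewrite powRrM -powRM ?powR_ge0 //; last by rewrite divr_ge0 // ltW.
apply: ge0_ler_powR; rewrite ?nnegrE //.
- exact: ltW.
- by rewrite mulr_ge0 ?powR_ge0 // divr_ge0 // ltW.
- exact: ln_ge0.
- exact: ln_scale_L_ge.
Qed.

(** Controls the first exponent, with [lambda] standing for 1 + ln l0. Sprinkling costs 2^(- beta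
    k), but r_k^gamma gains 2^(gamma floor(k^theta)). The bound on [r0] gives r0^gamma >= C^gamma
    lambda^2 >= C^gamma lambda; [3 <= C] later forces r0 >= 3. *)
Lemma scale_r_threshold theta beta gamma D K :
  1 < theta -> 0 < beta -> 0 < gamma -> 0 < D ->
  exists2 C : R, 3 <= C & forall (lambda s : R) r0 k, 1 <= lambda ->
    C * lambda `^ (2 / gamma) <= r0%:R ->
    (scale_r theta r0 k)%:R / 3 <= s ->
    K * lambda * 2 ^+ k <= (D / 2 ^+ k.+1) `^ beta * s `^ gamma.
Proof.
move=> th1 b0 g0 D0; wlog K1 : K / 1 <= K.
  move=> /(_ (Num.max K 1))[|C C3 hC]; first by rewrite le_max lexx orbT.
  exists C => // lambda s r0 k h1 h2 h3; apply: le_trans (hC _ _ _ _ h1 h2 h3).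
  by rewrite ler_wpM2r ?exprn_ge0 // ler_wpM2r ?le_max ?lexx //; lra.
(* In this slope, beta pays for the sprinkling and 1 for the factor 2^k on the left-hand side. *)
have bg : 0 <= (beta + 1) / gamma by rewrite divr_ge0 ?ltW //; lra.
have [M M0 hM] := natr_powR_superaffine th1 bg.
(* [E] collects the factors free of [k], [r0] and [lambda]; the 1 in [M + 1] accounts for the floor.
   [C] is then taken with C^gamma E >= K. *)
set E := (D / 2) `^ beta * 3^-1 `^ gamma * 2 `^ (- (gamma * (M + 1))).
have E0 : 0 < E by rewrite !mulr_gt0 ?powR_gt0 ?divr_gt0.
exists (Num.max 3 ((K / E) `^ gamma^-1)); first by rewrite le_max lexx.
move=> lambda s r0 k l1 hr hs; set C := Num.max _ _ in hr.
have C3 : 3 <= C by rewrite le_max lexx.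
have KE : 0 <= K / E by rewrite divr_ge0 // ?ltW //; lra.
have CE : K / E <= C `^ gamma by apply: ge_powRV; rewrite // le_max lexx orbT.
have Cl : C `^ gamma * lambda <= r0%:R `^ gamma.
  apply: (@le_trans _ _ ((C * lambda `^ (2 / gamma)) `^ gamma)).
    rewrite powRM ?powR_ge0 //; last by lra.
    rewrite -powRrM divfK ?lt0r_neq0 // ler_wpM2l ?powR_ge0 //.
    by rewrite le1r_powR // ler1n.
  apply: ge0_ler_powR; rewrite ?nnegrE ?ler0n //; first exact: ltW.
  by rewrite mulr_ge0 ?powR_ge0 //; lra.
set t := floor_powR theta k.
have st : r0%:R `^ gamma * 3^-1 `^ gamma * 2 `^ (gamma * t%:R) <= s `^ gamma.
  rewrite [gamma * _]mulrC powRrM powR_mulrn //.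
  rewrite -!powRM ?mulr_ge0 ?exprn_ge0 ?ler0n //.
  apply: ge0_ler_powR; rewrite ?nnegrE ?mulr_ge0 ?exprn_ge0 //.
  - exact: ltW.
  - by apply: le_trans hs; rewrite divr_ge0.
  - by apply: le_trans hs; rewrite natrM natrX mulrAC.
have Dk : (D / 2 ^+ k.+1) `^ beta = (D / 2) `^ beta * 2 `^ (- (beta * k%:R)).
  rewrite exprS invfM mulrA powRM ?divr_ge0 ?exprn_ge0 //; last exact: ltW.
  by rewrite powRN [beta * _]mulrC powRrM powR_mulrn // -powR_inv1 ?exprn_ge0 //
    powRAC powR_inv1 ?powR_ge0.
have t_ge : (beta + 1) * k%:R - gamma * (M + 1) <= gamma * t%:R.
  have := truncnS_gt (k%:R `^ theta : R); rewrite -[Num.truncn _]/t -natr1.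
  have := hM k; move: (k%:R `^ theta) => x h1 h2.
  have : (beta + 1) / gamma * k%:R <= t%:R + M + 1 by lra.
  by rewrite mulrAC ler_pdivrMr //; lra.
apply: (@le_trans _ _ ((D / 2 ^+ k.+1) `^ beta *
   (r0%:R `^ gamma * 3^-1 `^ gamma * 2 `^ (gamma * t%:R)))); last first.
  by rewrite ler_wpM2l ?powR_ge0.
have t2 : 2 ^+ k * 2 `^ (beta * k%:R) * 2 `^ (- (gamma * (M + 1))) <=
    2 `^ (gamma * t%:R) :> R.
  rewrite -powR_mulrn // -!powRD ?pnatr_eq0 ?implybT //.
  by apply: ler_powR => //; [rewrite ler1n | lra].
have p1 : 2 `^ (beta * k%:R) * 2 `^ (- (beta * k%:R)) = 1 :> R.
  by rewrite -powRD ?pnatr_eq0 ?implybT // subrr powRr0.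
have d0 := powR_ge0 (D / 2) beta; have h30 := powR_ge0 (3^-1 : R) gamma.
rewrite Dk.
apply: (@le_trans _ _ ((D / 2) `^ beta * 2 `^ (- (beta * k%:R)) *
   ((C `^ gamma * lambda) * 3^-1 `^ gamma *
    (2 ^+ k * 2 `^ (beta * k%:R) * 2 `^ (- (gamma * (M + 1))))))).
  have -> : (D / 2) `^ beta * 2 `^ (- (beta * k%:R)) *
   ((C `^ gamma * lambda) * 3^-1 `^ gamma *
    (2 ^+ k * 2 `^ (beta * k%:R) * 2 `^ (- (gamma * (M + 1))))) =
    (C `^ gamma * E) * lambda * 2 ^+ k *
    (2 `^ (beta * k%:R) * 2 `^ (- (beta * k%:R))) by rewrite /E; ring.
  rewrite p1 mulr1 ler_wpM2r ?exprn_ge0 // ler_wpM2r //; first by lra.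
  by rewrite -ler_pdivrMr.
rewrite ler_wpM2l ?mulr_ge0 ?powR_ge0 //.
rewrite ler_pM ?mulr_ge0 ?powR_ge0 ?exprn_ge0 //.
  by lra.
by rewrite ler_wpM2r ?powR_ge0.
Qed.

(** The left-hand side is the logarithm of 2 l_k^(2d), the cost of the union bound. It is ln 2 + 2d
    (ln l0 + floor(k^theta) ln 4), and k^theta = O((3/2)^k). *)
Lemma ln_scale_l_growth theta d : 0 < theta ->
  exists2 b0 : R, 0 <= b0 & forall l0 k, (0 < l0)%N ->
    ln 2 + 2 * d%:R * ln (scale_l theta l0 k)%:R <=
    b0 * (1 + ln l0%:R) * (3 / 2) ^+ k.
Proof.
move=> th0; have q1 : 1 < 3 / 2 :> R by lra.
have [M M0 hM] := natr_powR_le_exp th0 q1.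
have ln2 : 0 < ln (2 : R) by rewrite ln_gt0 // ltr1n.
have ln4 : 0 < ln (4 : R) by rewrite ln_gt0 // ltr1n.
exists (ln 2 + 2 * d%:R * (1 + M * ln 4)) => [|l0 k hl].
  by rewrite addr_ge0 ?mulr_ge0 ?addr_ge0 ?mulr_ge0 // ltW.
rewrite /scale_l natrM natrX lnM ?posrE ?ltr0n ?exprn_gt0 // lnXn //.
rewrite -[ln 4 *+ _]mulr_natl.
have l00 : 0 <= ln (l0%:R : R) by rewrite ln_ge0 // ler1n.
have hq : 1 <= (3 / 2) ^+ k :> R by rewrite exprn_ege1 //; lra.
have ht : (Num.truncn (k%:R `^ theta : R))%:R <= M * (3 / 2) ^+ k :> R.
  by apply: le_trans (hM k); rewrite truncn_le powR_ge0.
move: (Num.truncn _)%:R ht => t ht; set q : R := _ ^+ k in hq ht *.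
set l : R := ln l0%:R in l00 *; set d' : R := 2 * d%:R.
have d0 : 0 <= d' by rewrite mulr_ge0.
have h1 : t * ln 4 <= M * ln 4 * q by rewrite mulrAC ler_wpM2r // ltW.
have h2 : 1 <= (1 + l) * q by nra.
have h3 : l <= (1 + l) * q by nra.
have h4 : M * ln 4 * q <= M * ln 4 * ((1 + l) * q).
  by apply: ler_wpM2l; [rewrite mulr_ge0 // ltW | nra].
have h5 : d' * (l + t * ln 4) <= d' * ((1 + l) * q + M * ln 4 * ((1 + l) * q)).
  by rewrite ler_wpM2l //; lra.
have h6 : ln 2 <= ln 2 * ((1 + l) * q) by rewrite ler_peMr // ltW.
apply: le_trans (lerD h6 h5) _.
rewrite le_eqVlt; apply/orP; left; apply/eqP; ring.
Qed.

End Growth.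

(** * Local events and decoupling *)

Section Events.
Variable d : nat.
Implicit Types (S : set 'rV[int]_d) (A B : set (config d)).

Lemma sigma_coordS S S' A : S `<=` S' -> sigma_coord S A -> sigma_coord S' A.
Proof.
move=> SS'; apply: sub_smallest2r; first exact: smallest_sigma_algebra.
exact: bigcup_subset.
Qed.

Lemma sigma_coord_measurable S A : sigma_coord S A -> measurable A.
Proof. exact: (sigma_coordS (@subsetT _ S)). Qed.

Lemma sigma_coord0 S : sigma_coord S set0.
Proof. exact: (@measurable0 _ (g_sigma_algebraType (coord_gen S))). Qed.

Lemma sigma_coordT S : sigma_coord S setT.
Proof. exact: (@measurableT _ (g_sigma_algebraType (coord_gen S))). Qed.

Lemma sigma_coordU S A B :
  sigma_coord S A -> sigma_coord S B -> sigma_coord S (A `|` B).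
Proof. exact: (@measurableU _ (g_sigma_algebraType (coord_gen S))). Qed.

Lemma sigma_coordI S A B :
  sigma_coord S A -> sigma_coord S B -> sigma_coord S (A `&` B).
Proof. exact: (@measurableI _ (g_sigma_algebraType (coord_gen S))). Qed.

(** The closure properties shared by increasing and decreasing events, so that one proof serves both
    parts of the theorem. *)
Definition event_lattice (I : set (config d) -> Prop) : Prop :=
  [/\ I set0, I setT, forall A B, I A -> I B -> I (A `|` B)
   & forall A B, I A -> I B -> I (A `&` B)].

Lemma increasing_event_lattice : event_lattice (@increasing_event d).
Proof.
split=> // A B hA hB x w w' h h'.
- by case=> ?; [left; apply: hA | right; apply: hB]; eauto.
- by case=> ? ?; split; [apply: hA | apply: hB]; eauto.
Qed.

Lemma decreasing_event_lattice : event_lattice (@decreasing_event d).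
Proof.
have [h0 hT hU hI] := increasing_event_lattice.
split; rewrite /decreasing_event.
- by rewrite setC0.
- by rewrite setCT.
- by move=> A B hA hB; rewrite setCU; exact: hI.
- by move=> A B hA hB; rewrite setCI; exact: hU.
Qed.

Definition box_points (x : 'rV[int]_d) (M l : nat) : seq 'rV[int]_d :=
  [seq x + M%:Z *: map_mx (fun i : 'I_l => (i : nat)%:Z) z | z : 'rV['I_l]_d].

Lemma size_box_points x M l : size (box_points x M l) = (l ^ d)%N.
Proof. by rewrite size_map -cardE card_mx card_ord mul1n. Qed.

(** Dividing coordinates by [M] turns the cube condition into l integer values per coordinate. *)
Lemma mem_box_points x y (M l : nat) : (0 < M)%N ->
  lattice (l * M) x -> lattice M y -> cube x 0 (l * M)%:Z y ->
  y \in box_points x M l.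
Proof.
move=> M0 [zx _ <-] [zy _ <-] hc.
have hz i : 0 <= zy 0 i - l%:Z * zx 0 i < l%:Z.
  have := hc i; rewrite !mxE addr0 PoszM.
  have M0' : 0 < M%:Z by [].
  by move=> /andP[h1 h2]; apply/andP; split; nia.
have hl i : (absz (zy 0 i - l%:Z * zx 0 i)%R < l)%N by have := hz i; lia.
apply/fintype.imageP; exists (\row_i Ordinal (hl i)) => //.
apply/rowP => i; rewrite !mxE /= gez0_abs; last by case/andP: (hz i).
rewrite PoszM; ring.
Qed.

End Events.

(** * Sup norms of integer and real vectors *)

Section Norm.
Variables (R : realType) (d : nat).

Lemma norm_map_intr (x : 'rV[int]_d) :
  `|map_mx intr x : 'rV[R]_d| = (`|x|)%:~R.
Proof.
rewrite /Num.norm /= !mx_normrE.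
rewrite (big_morph (fun z : int => z%:~R : R) (id1 := 0) (op1 := Num.max)) //.
  by apply: eq_bigr => i _; rewrite !mxE intr_norm.
move=> a b /=; case: (leP a b) => h.
  by rewrite max_r ?ler_int.
by rewrite max_l ?ler_int // ltW.
Qed.

(** Lets the conditions D, stated for balls, apply to the cubes on which scale-k events depend. *)
Lemma cube_sub_lball (x : 'rV[int]_d) (M : nat) :
  cube x (- M%:Z) (3 * M%:Z) `<=` lball (map_mx intr x : 'rV[R]_d) (3 * M%:R).
Proof.
move=> y hy; rewrite /lball /= -map_mxB norm_map_intr.
suff h : `|y - x| <= 3 * M%:Z by rewrite -(ler_int R) intrM in h.
rewrite /Num.norm /= mx_normrE; apply: bigmax_le => // i _.
have key (p q : int) :
  q - M%:Z <= p < q + 3 * M%:Z -> `|p - q| <= 3 * M%:Z by lia.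
by rewrite !mxE (ord1 i.1); exact: key (hy i.2).
Qed.

Lemma norm_const_rV (a : R) : (0 < d)%N -> 0 <= a ->
  `|const_mx a : 'rV[R]_d| = a.
Proof.
move=> d0 a0; rewrite /Num.norm /= mx_normrE; apply/le_anti/andP; split.
  by apply: bigmax_le => // i _; rewrite mxE ger0_norm.
have := @le_bigmax _ _ _ (0 : R)
  (fun i : 'I_1 * 'I_d => `|(const_mx a : 'rV_d) i.1 i.2|) (ord0, Ordinal d0).
by rewrite /= mxE ger0_norm.
Qed.

End Norm.

(** * Decoupling along a segment of parameters *)

Section Decoupling.
Variables (R : realType) (d : nat) (CD c beta gamma zeta : R).
Hypotheses (c0 : 0 < c) (gamma0 : 0 < gamma) (zeta0 : 0 < zeta).

(** Replacing [CD] by 1 + |CD| >= 1 lets the prefactor move into the exponent whatever the sign of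
    [CD]. *)
Lemma decoupling_error_le (h s L T : R) :
  T <= h `^ beta * s `^ gamma -> T <= expR (ln L `^ zeta) ->
  decoupling_error CD c beta gamma zeta h s L
  <= expR (ln (1 + `|CD|) - c * T).
Proof.
move=> h1 h2; rewrite /decoupling_error expRD lnK; last first.
  by rewrite posrE ltr_pwDl.
set m := Num.min _ _.
apply: (@le_trans _ _ ((1 + `|CD|) * expR (- c * m))).
  rewrite ler_wpM2r ?expR_ge0 //; have := ler_norm CD; lra.
rewrite ler_wpM2l ?addr_ge0 // ler_expR mulNr lerN2 ler_pM2l //.
by rewrite le_min h1 h2.
Qed.

(** Both conditions D(a) and D(b), along the segment from [u] (at [t = 0])
    to [u'] (at [t = 1]), with [D = |u' - u|]. *)
Definition decoupled (D : R) (Q : R -> probability (config d) R)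
    (I : set (config d) -> Prop) : Prop :=
  forall (L s : R) (x1 x2 : 'rV[R]_d) (t t' : R) (A1 A2 : set (config d)),
    1 <= L -> 1 <= s -> `|x1 - x2| = s * L ->
    0 <= t -> t < t' -> t' <= 1 ->
    sigma_coord (lball x1 L) A1 -> sigma_coord (lball x2 L) A2 ->
    I A1 -> I A2 ->
    (Q t (A1 `&` A2) <= Q t' A1 * Q t' A2 +
       (decoupling_error CD c beta gamma zeta (D * (t' - t)) s L)%:E)%E.

Variables (D : R) (Q : R -> probability (config d) R)
  (I : set (config d) -> Prop).
Hypotheses (d0 : (0 < d)%N) (D0 : 0 < D) (latI : event_lattice I)
  (decQ : decoupled D Q I).

(** With the sure event as second event, decoupling reads Q_t(A) <= Q_t'(A) + error, and the error
    is arbitrarily small since [L] and [s] are free. *)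
Lemma decoupled_monotone (x : 'rV[R]_d) (r t t' : R) A :
  0 <= t -> t < t' -> t' <= 1 ->
  sigma_coord (lball x r) A -> I A -> (Q t A <= Q t' A)%E.
Proof.
move=> t0 tt' t1 sA IA; have [_ IT _ _] := latI.
apply/lee_addgt0Pr => e e0.
set h := D * (t' - t); have h0 : 0 < h by rewrite mulr_gt0 // subr_gt0.
(* [T] solves (1 + |CD|) exp (- c T) = e. Then [s] and [L] make both entries of the minimum at least
   |T|, and [L >= r] keeps [A] local; the absolute value is there because [T] may be negative. *)
set T := (ln (1 + `|CD|) - ln e) / c.
have hb0 : 0 < h `^ beta by exact: powR_gt0.
set s := Num.max 1 ((`|T| / h `^ beta) `^ gamma^-1).
set L := Num.max (Num.max 1 r) (expR (`|T| `^ zeta^-1)).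
have s1 : 1 <= s by rewrite le_max lexx.
have L1 : 1 <= L by rewrite !le_max lexx.
have sL0 : 0 <= s * L by rewrite mulr_ge0 //; lra.
have hn : `|x - (x - const_mx (s * L))| = s * L.
  by rewrite opprB addrC subrK norm_const_rV.
have sAL : sigma_coord (lball x L) A.
  apply: sigma_coordS sA => y /= hy; apply: le_trans hy _.
  by rewrite !le_max lexx orbT.
have sT : sigma_coord (lball (x - const_mx (s * L)) L) setT.
  exact: sigma_coordT.
have := decQ L1 s1 hn t0 tt' t1 sAL sT IA IT.
rewrite setIT probability_setT mule1 => /le_trans; apply.
rewrite leeD2l // lee_fin.
have -> : e = expR (ln (1 + `|CD|) - c * T).
  by rewrite /T mulrC divfK ?lt0r_neq0 // subKr lnK.
apply: decoupling_error_le; apply: le_trans (ler_norm T) _.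
- rewrite mulrC -ler_pdivrMr //; apply: ge_powRV => //.
    by rewrite divr_ge0 // ltW.
  by rewrite le_max lexx orbT.
- apply: (@le_trans _ _ (expR `|T|)).
    by apply: le_trans (expR_ge1Dx _); rewrite lerDr.
  rewrite ler_expR; apply: ge_powRV => //.
  rewrite -[leLHS]expRK ler_ln ?posrE ?expR_gt0 //; last by lra.
  by rewrite le_max lexx orbT.
Qed.

End Decoupling.

(** * Cascading events *)

Lemma measure_bigsetU_le (disp : measure_display) (T : measurableType disp)
    (R : realType) (P : {measure set T -> \bar R}) (J : eqType) (s : seq J)
    (F : J -> set T) (e : R) :
  (forall j, j \in s -> measurable (F j)) ->
  (forall j, j \in s -> (P (F j) <= e%:E)%E) ->
  (P (\big[setU/set0]_(j <- s) F j) <= ((size s)%:R * e)%:E)%E.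
Proof.
elim: s => [|j s IH] mF hF; first by rewrite big_nil measure0 mul0r.
have mF' i : i \in s -> measurable (F i).
  by move=> h; apply: mF; rewrite inE h orbT.
rewrite big_cons; apply: le_trans (measureU2 _ _ _) _.
- by apply: mF; rewrite mem_head.
- rewrite big_seq; apply: (big_ind (@measurable _ T)) => //.
  exact: measurableU.
rewrite /= -natr1 mulrDl mul1r addrC EFinD leeD //.
  by apply: IH => // i h; apply: hF; rewrite inE h orbT.
by apply: hF; rewrite mem_head.
Qed.

Section Cascade.
Variables (R : realType) (d : nat) (theta : R) (l0 r0 L0 : nat)
  (G : nat -> 'rV[int]_d -> set (config d)).
Hypotheses (l0_gt0 : (0 < l0)%N) (L0_gt0 : (0 < L0)%N).
Let Lk := scale_L theta l0 L0.
Let casc := cascade theta l0 r0 L0 G.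

Definition separated_pair k (x : 'rV[int]_d) (p : 'rV[int]_d * 'rV[int]_d) :=
  [/\ (lattice (Lk k) `&` cube x 0 (Lk k.+1)%:Z) p.1,
      (lattice (Lk k) `&` cube x 0 (Lk k.+1)%:Z) p.2 &
      (scale_r theta r0 k * Lk k)%N%:Z < `|p.1 - p.2|].

(** The cube contains at most l_k^d points of the finer lattice, hence at most l_k^(2d) pairs;
    finiteness serves both measurability and the union bound. *)
Lemma cascade_finite_union k x : lattice (Lk k.+1) x ->
  exists s : seq ('rV[int]_d * 'rV[int]_d),
    [/\ (size s <= scale_l theta l0 k ^ (2 * d))%N,
        forall p, p \in s -> separated_pair k x p &
        casc k.+1 x = \big[setU/set0]_(p <- s) (casc k p.1 `&` casc k p.2)].
Proof.
move=> hx; set b := box_points x (Lk k) (scale_l theta l0 k).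
exists [seq p <- [seq (y, z) | y <- b, z <- b] | `[< separated_pair k x p >]].
split.
- rewrite size_filter; apply: leq_trans (count_size _ _) _.
  by rewrite size_allpairs size_box_points mulnC expnM mulnn.
- by move=> p; rewrite mem_filter => /andP[/asboolP].
rewrite -bigcup_seq; apply/seteqP; split=> w [p /= hp hw]; exists p => //=;
  last first.
  by move: hp; rewrite mem_filter => /andP[/asboolP].
rewrite mem_filter; apply/andP; split; first exact/asboolP.
have hL : (0 < Lk k)%N by exact: scale_L_gt0.
case: hp => -[h1 h2] [h3 h4] _; rewrite (surjective_pairing p).
by apply: allpairs_f; apply: mem_box_points.
Qed.

(** By induction: the enlarged cube of each subcube lies in the enlarged cube of its parent, and
    finite unions and intersections preserve both properties. *)
Lemma cascade_local k x (I : set (config d) -> Prop) :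
  event_lattice I -> seed_family G ->
  (forall y, lattice L0 y -> I (G L0 y)) -> lattice (Lk k) x ->
  sigma_coord (cube x (- (Lk k)%:Z) (3 * (Lk k)%:Z)) (casc k x) /\ I (casc k x).
Proof.
move=> [I0 _ IU II] sG IG; elim: k x => [|k IH] x hx.
  by split; [exact: sG | exact: IG].
have [s [_ hs ->]] := cascade_finite_union hx.
set S := cube x _ _.
rewrite big_seq; apply: (big_ind (fun A => sigma_coord S A /\ I A)).
- by split=> //; exact: sigma_coord0.
- move=> A B [sA IA] [sB IB]; split; [exact: sigma_coordU | exact: IU].
move=> p /hs [[h1 c1] [h2 c2] _].
have [s1 I1] := IH _ h1; have [s2 I2] := IH _ h2.
have sub y : lattice (Lk k) y -> cube x 0 (Lk k.+1)%:Z y ->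
    cube y (- (Lk k)%:Z) (3 * (Lk k)%:Z) `<=` S.
  case: hx => zx _ xE [zy _ <-] cy z hz i; have := cy i; have := hz i.
  rewrite -xE /Lk /= -/Lk !mxE PoszM.
  have key (l m a b v : int) : 0 < l -> 0 < m ->
      m * b - m <= v < m * b + 3 * m ->
      l * m * a + 0 <= m * b < l * m * a + l * m ->
      l * m * a - l * m <= v < l * m * a + 3 * (l * m).
    move=> l_gt0 m_gt0 /andP[v1 v2] /andP[b1 b2].
    (* Integrality in units of m gains a full m, so that m b + 3 m <= l m a + 3 l m holds even for l
       = 1. *)
    have b3 : b + 1 <= l * a + l by nia.
    have b4 : l * a <= b by nia.
    apply/andP; split; nia.
  apply: key; rewrite ltz_nat; [exact: scale_l_gt0 | exact: scale_L_gt0].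
split; last exact: II.
by apply: sigma_coordI; [exact: sigma_coordS (sub _ h1 c1) s1
                       | exact: sigma_coordS (sub _ h2 c2) s2].
Qed.

Section Step.
Variables (CD c beta gamma zeta D : R) (Q : R -> probability (config d) R)
  (I : set (config d) -> Prop).
Hypotheses (latI : event_lattice I) (sG : seed_family G)
  (IG : forall y, lattice L0 y -> I (G L0 y))
  (decQ : decoupled CD c beta gamma zeta D Q I).

(** Each pair is decoupled with radius 3 L_k and s = |x1 - x2| / (3 L_k). Separation by more than
    r_k L_k gives s >= r_k / 3, which is at least 1 as r_k >= 3. *)
Lemma cascade_step k (t t' q e : R) :
  0 <= t -> t < t' -> t' <= 1 -> (3 <= scale_r theta r0 k)%N ->
  0 <= q -> 0 <= e ->
  (forall s, (scale_r theta r0 k)%:R / 3 <= s ->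
     decoupling_error CD c beta gamma zeta (D * (t' - t)) s (3 * (Lk k)%:R)
     <= e) ->
  (forall x, lattice (Lk k) x -> (Q t' (casc k x) <= q%:E)%E) ->
  forall x, lattice (Lk k.+1) x ->
    (Q t (casc k.+1 x) <=
     ((scale_l theta l0 k)%:R ^+ (2 * d) * (q ^+ 2 + e))%:E)%E.
Proof.
move=> t0 tt' t1 r3 q0 e0 he hq x hx.
have [s [ss hs ->]] := cascade_finite_union hx.
have L_gt0 : (0 < Lk k)%N by exact: scale_L_gt0.
have L0' : 0 < (Lk k)%:R :> R by rewrite ltr0n.
have r0' : 0 <= (scale_r theta r0 k)%:R / 3 :> R by rewrite divr_ge0.
have pair_bound p : p \in s ->
    measurable (casc k p.1 `&` casc k p.2) /\
    (Q t (casc k p.1 `&` casc k p.2) <= (q ^+ 2 + e)%:E)%E.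
  move=> /hs [[h1 c1] [h2 c2] hp].
  have [s1 I1] := cascade_local latI sG IG h1.
  have [s2 I2] := cascade_local latI sG IG h2.
  split.
    by apply: measurableI; [exact: sigma_coord_measurable s1
                          | exact: sigma_coord_measurable s2].
  have sb y : sigma_coord (cube y (- (Lk k)%:Z) (3 * (Lk k)%:Z)) `<=`
      sigma_coord (lball (map_mx intr y : 'rV[R]_d) (3 * (Lk k)%:R)).
    by move=> A; apply: sigma_coordS; exact: cube_sub_lball.
  set N : R := `|map_mx intr p.1 - map_mx intr p.2 : 'rV[R]_d|.
  have hN : (scale_r theta r0 k)%:R * (Lk k)%:R <= N.
    rewrite /N -map_mxB norm_map_intr -natrM ltW //.
    by rewrite -[ltLHS]/((_%:Z)%:~R) ltr_int.
  have L3 : 0 < 3 * (Lk k)%:R :> R by rewrite mulr_gt0.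
  have sr : (scale_r theta r0 k)%:R / 3 <= N / (3 * (Lk k)%:R).
    by rewrite ler_pdivlMr // mulrA divfK.
  have s_ge1 : 1 <= N / (3 * (Lk k)%:R).
    by apply: le_trans sr; rewrite ler_pdivlMr // mul1r ler_nat.
  have L1 : 1 <= 3 * (Lk k)%:R :> R by rewrite -natrM ler1n muln_gt0.
  have hn : N = N / (3 * (Lk k)%:R) * (3 * (Lk k)%:R).
    by rewrite divfK // lt0r_neq0.
  apply: le_trans (decQ L1 s_ge1 hn t0 tt' t1 (sb _ _ s1) (sb _ _ s2) I1 I2) _.
  rewrite EFinD leeD ?lee_fin ?he // expr2 EFinM lee_pmul ?measure_ge0 ?hq //.
apply: le_trans (measure_bigsetU_le (fun p h => (pair_bound p h).1)
  (fun p h => (pair_bound p h).2)) _.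
by rewrite lee_fin ler_wpM2r ?addr_ge0 ?sqr_ge0 // -natrX ler_nat.
Qed.
End Step.
End Cascade.

(** The liminf is the supremum of the tail infima, so every tail infimum is at most 0 < e. *)
Lemma limn_einf0_frequently (R : realType) (v : nat -> \bar R)
    (e : R) (N : nat) :
  limn_einf v = 0%E -> 0 < e -> exists2 n, (N <= n)%N & (v n <= e%:E)%E.
Proof.
move=> v0 e0.
have : (einfs v N <= 0)%E.
  rewrite -v0 limn_einf_lim (cvg_lim _ (@cvg_einfs_sup _ v)) //.
  by apply: ereal_sup_ubound; exists N.
rewrite /einfs => /le_lt_trans /(_ (_ : 0 < e%:E)%E) => /(_ e0) /ereal_inf_lt.
by case=> _ [n /= nN <-] /ltW ve; exists n.
Qed.

(** * Induction over scales and choice of the constants *)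

Section Main.
Variables (R : realType) (d : nat) (theta CD c beta gamma zeta D : R).
Hypotheses (d0 : (0 < d)%N) (c0 : 0 < c) (beta0 : 0 < beta) (gamma0 : 0 < gamma)
  (zeta0 : 0 < zeta) (D0 : 0 < D) (theta1 : 1 < theta)
  (thz : 1 < (theta + 1) * zeta).

Let theta0 : 0 < theta. Proof. exact: lt_trans theta1. Qed.

(** The sequence w_k of the overview; [b] is the constant of [ln_scale_l_growth], not an endpoint of
    the parameter interval. *)
Definition rate (b lambda : R) (k : nat) : R :=
  ln 2 * 2 ^+ k + 2 * b * lambda * (3 / 2) ^+ k.

(** Brings 2 w_k to the form constant * lambda * 2^k treated by the two threshold lemmas. *)
Lemma rate_upper b lambda k : 0 <= b -> 1 <= lambda ->
  2 * rate b lambda k <= 2 * (ln 2 + 2 * b) * lambda * 2 ^+ k.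
Proof.
move=> b0 l1; have ln2 : 0 < ln (2 : R) by rewrite ln_gt0 // ltr1n.
have q1 : 0 < (2 : R) ^+ k by rewrite exprn_gt0.
have qq : (3 / 2) ^+ k <= (2 : R) ^+ k.
  by apply: lerXn2r; rewrite ?nnegrE //; lra.
have bl : 0 <= b * lambda by rewrite mulr_ge0 //; lra.
have h1 := ler_wpM2l bl qq.
have h2 : ln 2 * 2 ^+ k <= ln 2 * 2 ^+ k * lambda.
  by rewrite ler_peMr // mulr_ge0 // ltW.
by rewrite /rate; lra.
Qed.

Lemma rateS b lambda k :
  rate b lambda k.+1 + b * lambda * (3 / 2) ^+ k = 2 * rate b lambda k.
Proof. by rewrite /rate !exprS; field. Qed.

(** The numerical hypotheses are the outputs of the growth lemmas. [K] is such that c K lambda 2^k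
    >= ln (1 + |CD|) + 2 w_k, which makes the error at scale k at most exp (- 2 w_k). *)
Lemma cascade_bound_of_seed (b : R) (l0 r0 L0 : nat)
    (Q : R -> probability (config d) R)
    (I : set (config d) -> Prop) (G : nat -> 'rV[int]_d -> set (config d)) :
  let lambda : R := 1 + ln l0%:R in
  let K := (ln (1 + `|CD|) + 2 * (ln 2 + 2 * b)) / c in
  0 <= b -> (0 < l0)%N -> (0 < L0)%N ->
  (forall k, ln 2 + 2 * d%:R * ln (scale_l theta l0 k)%:R
             <= b * lambda * (3 / 2) ^+ k) ->
  (forall s k, (scale_r theta r0 k)%:R / 3 <= s ->
     K * lambda * 2 ^+ k <= (D / 2 ^+ k.+1) `^ beta * s `^ gamma) ->
  (forall k, K * lambda * 2 ^+ k <=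
     expR (ln (3 * (scale_L theta l0 L0 k)%:R) `^ zeta)) ->
  (3 <= r0)%N ->
  event_lattice I -> seed_family G -> (forall y, lattice L0 y -> I (G L0 y)) ->
  decoupled CD c beta gamma zeta D Q I ->
  (seed_sup (Q 1%R) G L0 <= (expR (- rate b lambda 0))%:E)%E ->
  cascade_bound theta l0 r0 L0 (Q 0) G.
Proof.
move=> lambda K b0 hl hL hb hr hz r3 latI sG IG decQ seed.
have l1 : 1 <= lambda by rewrite lerDl ln_ge0 // ler1n.
have ln2 : 0 < ln (2 : R) by rewrite ln_gt0 // ltr1n.
have lCD : 0 <= ln (1 + `|CD|) by rewrite ln_ge0 // lerDl.
(* Scale 0 uses t = 1, where the seeds are controlled; passing from scale k to k + 1 spends t_k -
   t_(k+1) = 2^-(k+1). *)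
set t := fun k => (2 ^- k : R).
have t_gt0 k : 0 < t k by rewrite invr_gt0 exprn_gt0.
have t_le1 k : t k <= 1 by rewrite invf_le1 ?exprn_gt0 // exprn_ege1 // ler1n.
have tS k : t k.+1 = t k / 2 by rewrite /t exprS invfM mulrC.
have main k : forall x, lattice (scale_L theta l0 L0 k) x ->
    (Q (t k) (cascade theta l0 r0 L0 G k x)
      <= (expR (- rate b lambda k))%:E)%E.
  elim: k => [|k IH] x hx.
    rewrite /t expr0 invr1; apply: le_trans seed.
    by apply: ereal_sup_ubound; exists x.
  have tt : t k.+1 < t k by rewrite tS; have := t_gt0 k; lra.
  apply: (@le_trans _ _ ((scale_l theta l0 k)%:R ^+ (2 * d) *
    (expR (- rate b lambda k) ^+ 2 + expR (- (2 * rate b lambda k))))%:E).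
    apply: (cascade_step hl hL latI sG IG decQ) (ltW (t_gt0 _)) tt
      (t_le1 _) _ _ _ _ IH _ hx.
    - by apply: leq_trans r3 _; rewrite leq_pmulr // expn_gt0.
    - exact: expR_ge0.
    - exact: expR_ge0.
    move=> s hs; apply: le_trans
      (decoupling_error_le (T := K * lambda * 2 ^+ k) _ _ _ _) _ => //.
      have -> : D * (t k - t k.+1) = D / 2 ^+ k.+1.
        by rewrite -[_^-1]/(t k.+1) tS; field.
      exact: hr.
    rewrite ler_expR /K 2!mulrA [c * (_ / c)]mulrC divfK ?lt0r_neq0 //.
    have := rate_upper k b0 l1.
    have q1 : 1 <= lambda * 2 ^+ k.
      by rewrite mulr_ege1 // exprn_ege1 // ler1n.
    have := ler_peMr lCD q1.
    by lra.
  rewrite lee_fin.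
  have -> : expR (- rate b lambda k) ^+ 2 = expR (- (2 * rate b lambda k)).
    by rewrite -mulrN expRM_natl.
  have -> : (scale_l theta l0 k)%:R ^+ (2 * d) =
      expR (2 * d%:R * ln (scale_l theta l0 k)%:R) :> R.
    by rewrite -natrM expRM_natl lnK // posrE ltr0n scale_l_gt0.
  (* Squared probability and error have the same bound; their factor 2 joins the union-bound factor,
     and [hb] absorbs both. *)
  have -> (y : R) : y + y = expR (ln 2) * y by rewrite lnK ?posrE //; ring.
  rewrite -!expRD ler_expR.
  have := rateS b lambda k; have := hb k; lra.
move=> k; apply: ge_ereal_sup => _ [x hx <-].
have [sx Ix] := cascade_local r0 hl hL latI sG IG hx.
(* Monotonicity passes from 0 to t_k; the correction term of w_k is then dropped, leaving
   2^(-2^k). *)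
apply: le_trans (_ : Q (t k) (cascade theta l0 r0 L0 G k x) <= _)%E.
  apply: (decoupled_monotone c0 gamma0 zeta0 d0 D0 latI decQ (lexx 0)
    (t_gt0 k) (t_le1 k) _ Ix).
  by apply: sigma_coordS sx; exact: cube_sub_lball.
apply: le_trans (main k x hx) _; rewrite lee_fin.
have -> : 2 ^- (2 ^ k) = expR (- (ln 2 * 2 ^+ k)) :> R.
  by rewrite expRN -[X in expR (_ * X)]natrX expRM_natr lnK // posrE.
rewrite ler_expR lerN2 lerDl mulr_ge0 ?exprn_ge0 ?mulr_ge0 //; lra.
Qed.

(** The order of choices matters: [C] comes before the laws, the seeds and [l0]; the threshold [N]
    on [L0] depends on [l0] but not on [r0]. *)
Lemma cascade_conclusion_of_decoupled :
  exists C : R, forall (Q : R -> probability (config d) R)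
    (I : set (config d) -> Prop) (G : nat -> 'rV[int]_d -> set (config d)),
  event_lattice I -> seed_family G ->
  (forall L0 y, (1 <= L0)%N -> lattice L0 y -> I (G L0 y)) ->
  decoupled CD c beta gamma zeta D Q I ->
  limn_einf (seed_sup (Q 1) G) = 0%E ->
  cascade_conclusion theta gamma C (Q 0) (Q 1) G.
Proof.
have [b b0 hb] := ln_scale_l_growth d theta0.
set K := (ln (1 + `|CD|) + 2 * (ln 2 + 2 * b)) / c.
have [C C3 hC] := scale_r_threshold K theta1 beta0 gamma0 D0.
exists C => Q I G latI sG IG decQ liminf.
have bound l0 : (0 < l0)%N -> exists N : nat, forall r0 L0,
    C * (1 + ln l0%:R) `^ (2 / gamma) <= r0%:R -> (0 < L0)%N -> (N <= L0)%N ->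
    (seed_sup (Q 1%R) G L0 <= (expR (- rate b (1 + ln l0%:R) 0))%:E)%E ->
    cascade_bound theta l0 r0 L0 (Q 0) G.
  move=> hl; have [N hN] :=
    scale_L_threshold (K * (1 + ln l0%:R)) theta0 zeta0 thz.
  have l1 : 1 <= 1 + ln l0%:R :> R by rewrite lerDl ln_ge0 // ler1n.
  exists N => r0 L0 hr hL NL.
  apply: (@cascade_bound_of_seed b l0 r0 L0 Q I G) => //.
  - by move=> k; exact: hb.
  - by move=> s k; exact: hC.
  - by move=> k; exact: hN.
  - rewrite -(ler_nat R); apply: le_trans hr; apply: (le_trans C3).
    rewrite ler_peMr //; first by lra.
    rewrite -[leLHS](powRr0 (1 + ln l0%:R)); apply: ler_powR => //.
    by rewrite divr_ge0 // ltW.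
  - by move=> y; exact: IG.
split=> [l0 r0 hl _ hr|lim0 l0 hl]; have [N hN] := bound l0 hl.
  (* The liminf supplies small seed probabilities at arbitrarily large [L0], in particular beyond
     [N]; the 1 secures L0 >= 1. *)
  have [L0 NL seed] := limn_einf0_frequently (maxn N 1) liminf
    (expR_gt0 (- rate b (1 + ln l0%:R) 0)).
  move: NL; rewrite geq_max => /andP[NL hL].
  by exists L0 => //; exact: hN.
have e0 : (0 < (expR (- rate b (1 + ln l0%:R) 0))%:E)%E.
  by rewrite lte_fin expR_gt0.
have [N' _ hN'] := lim0 _ (open_ereal_lt' e0).
exists (maxn N N')%:R => r0 L0 _ hL hr.
rewrite ler_nat geq_max => /andP[NL N'L].
by apply: hN => //; apply/ltW/hN'.
Qed.

End Main.

Theorem theorem6p4 (R : realType) (d : nat) (a b theta : R)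
    (CD c beta gamma zeta : R) (u' : R) :
  (2 <= d)%N -> 0 < a -> a < b ->
  0 < c -> 0 < beta -> 0 < gamma -> 0 < zeta ->
  1 < theta -> 1 < (theta + 1) * zeta ->
  a < u' -> u' < b ->
  (forall u : R, a < u -> u < u' ->
   exists C : R,
     forall (P : R -> probability (config d) R)
            (G : nat -> 'rV[int]_d -> set (config d)),
       cond_Da a b P CD c beta gamma zeta ->
       seed_family G -> seed_increasing G ->
       limn_einf (seed_sup (P u') G) = 0%E ->
       cascade_conclusion theta gamma C (P u) (P u') G)
  /\
  (forall u : R, u' < u -> u < b ->
   exists C : R,
     forall (P : R -> probability (config d) R)
            (G : nat -> 'rV[int]_d -> set (config d)),
       cond_Db a b P CD c beta gamma zeta ->
       seed_family G -> seed_decreasing G ->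
       limn_einf (seed_sup (P u') G) = 0%E ->
       cascade_conclusion theta gamma C (P u) (P u') G).
Proof.
move=> d2 _ _ c0 beta0 gamma0 zeta0 theta1 thz au' u'b.
have d0 : (0 < d)%N by exact: ltnW.
have end0 u : u + 0 * (u' - u) = u by rewrite mul0r addr0.
have end1 u : u + 1 * (u' - u) = u' by rewrite mul1r addrC subrK.
split=> u.
- move=> au uu'; have D0 : 0 < u' - u by rewrite subr_gt0.
  have [C hC] := cascade_conclusion_of_decoupled CD d0 c0 beta0 gamma0 zeta0 D0
    theta1 thz.
  exists C => P G dec sG IG liminf.
  (* The affine parametrization sends 0 to u and 1 to u', with D = u' - u. *)
  have := hC (fun t => P (u + t * (u' - u))) (@increasing_event d) G.
  rewrite /= end0 end1; apply=> //; first exact: increasing_event_lattice.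
  move=> L s x1 x2 t t' A1 A2 L1 s1 x12 t0 tt' t'1 sA1 sA2 IA1 IA2.
  have -> : (u' - u) * (t' - t) =
    (u + t' * (u' - u)) - (u + t * (u' - u)) by ring.
  by apply: (dec L s x1 x2) => //; nra.
- move=> u'u ub; have D0 : 0 < u - u' by rewrite subr_gt0.
  have [C hC] := cascade_conclusion_of_decoupled CD d0 c0 beta0 gamma0 zeta0 D0
    theta1 thz.
  exists C => P G dec sG IG liminf.
  (* Here u' < u, so the parameter decreases as t grows: D(b) bounds the law at the larger parameter
     by the one at the smaller, again the law at t by that at t' > t. *)
  have := hC (fun t => P (u + t * (u' - u))) (@decreasing_event d) G.
  rewrite /= end0 end1; apply=> //; first exact: decreasing_event_lattice.
  move=> L s x1 x2 t t' A1 A2 L1 s1 x12 t0 tt' t'1 sA1 sA2 IA1 IA2.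
  have -> : (u - u') * (t' - t) =
    (u + t * (u' - u)) - (u + t' * (u' - u)) by ring.
  by apply: (dec L s x1 x2) => //; nra.
Qed.
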